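(* Let $V$ be a real euclidean vector space of finite dimension $p\ge 1$ and let $\Delta$ be a basis of $V$. Let $\mathcal P(\Delta)$ be the set of ordered partitions of $\Delta$. Then for all $\Lambda\in V$ and all $H\in V$, $$\sum_{\mathfrak p\in\mathcal P(\Delta)}(-1)^{\alpha^\Lambda_{\mathfrak p}}\,\phi_{\mathfrak p}^\Lambda(H)=d_\Delta(\Lambda)+\sum_{\mathfrak p\in\mathcal P(\Delta)}(-1)^{\beta^\Lambda_{\mathfrak p}}\,\psi_{\mathfrak p}^\Lambda(H).$$
   Context: Vectors of $V$ are also regarded as linear forms through the inner product: $\lambda(H)=\langle\lambda,H\rangle$. Let $\widehat\Delta\subset V$ be the basis dual to $\Delta$ and $D:\Delta\to\widehat\Delta$ the canonical bijection, so that $\langle D(\lambda),\lambda'\rangle=\delta_{\lambda,\lambda'}$ for $\lambda,\lambda'\in\Delta$. The basis $\Delta$ is not assumed obtuse, and $\Lambda,H$ are not assumed regular. An ordered partition $\mathfrak p$ of $\Delta$ is a sequence $(F^1_{\mathfrak p},\dots,F^r_{\mathfrak p})$, $r=r(\mathfrak p)\ge1$, of nonempty pairwise disjoint subsets with union $\Delta$; let $a^u_{\mathfrak p}$ be the cardinality of $F^u_{\mathfrak p}$. Put $E^v_{\mathfrak p}=\bigcup_{u\le v}F^u_{\mathfrak p}$ for $0\le v\le r$ (so $E^0_{\mathfrak p}=\emptyset$), let $U^v_{\mathfrak p}$ be the span of $D(E^v_{\mathfrak p})$ and $V^v_{\mathfrak p}$ the span of $\Delta\setminus E^v_{\mathfrak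 p}$; then $V=U^v_{\mathfrak p}\oplus V^v_{\mathfrak p}$ orthogonally. Let $W^u_{\mathfrak p}$ be the orthogonal complement of $U^{u-1}_{\mathfrak p}$ in $U^u_{\mathfrak p}$ (equivalently of $V^u_{\mathfrak p}$ in $V^{u-1}_{\mathfrak p}$), so $V=\bigoplus_{u=1}^r W^u_{\mathfrak p}$ orthogonally. For $\lambda\in F^u_{\mathfrak p}$ and $\mu=D(\lambda)\in\widehat F^u_{\mathfrak p}:=D(F^u_{\mathfrak p})$, let $\lambda_{\mathfrak p}$ and $\mu_{\mathfrak p}$ be the orthogonal projections of $\lambda$ and $\mu$ on $W^u_{\mathfrak p}$. $\bullet$ $\phi^\Lambda_{\mathfrak p}$ is the characteristic function of the set of $H\in V$ such that for all $\lambda\in\Delta$, with $\mu=D(\lambda)$: $\lambda_{\mathfrak p}(H)\le0$ if $\mu_{\mathfrak p}(\Lambda)>0$, and $\lambda_{\mathfrak p}(H)>0$ if $\mu_{\mathfrak p}(\Lambda)\le 0$. $\bullet$ $\psi^\Lambda_{\mathfrak p}$ is the characteristic function of the set of $H\in V$ such that $\lambda_{\mathfrak p}(H)>0$ for all $\lambda\in F^1_{\mathfrak p}$ and, for all $\lambda\in\Delta\setminus F^1_{\mathfrak p}$ with $\mu=D(\lambda)$: $\lambda_{\mathfrak p}(H)\le0$ if $\mu_{\mathfrak p}(\Lambda)>0$, and $\lambda_{\mathfrak p}(H)>0$ if $\mu_{\mathfrak p}(\Lambda)\le0$. $\bullet$ $b^\Lambda_{\mathfrak p}$ is the number of $\mu\in\widehat\Delta$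 with $\mu_{\mathfrak p}(\Lambda)\le0$, and $c^\Lambda_{\mathfrak p}$ is the number of such $\mu$ that moreover satisfy $\mu\notin\widehat F^1_{\mathfrak p}$. $\bullet$ $\alpha^\Lambda_{\mathfrak p}=b^\Lambda_{\mathfrak p}+\sum_{u=1}^{r}(a^u_{\mathfrak p}+1)$ and $\beta^\Lambda_{\mathfrak p}=1+c^\Lambda_{\mathfrak p}+\sum_{u=2}^{r}(a^u_{\mathfrak p}+1)$. $\bullet$ $d_\Delta(\Lambda)=1$ if $\lambda(\Lambda)>0$ for all $\lambda\in\Delta$, and $d_\Delta(\Lambda)=0$ otherwise. *)

(* Defs.v *)
From HB Require Import structures.
From mathcomp Require Import all_boot all_order all_algebra.
From mathcomp Require Import reals.

Set Implicit Arguments.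
Unset Strict Implicit.
Unset Printing Implicit Defensive.

Import Order.TTheory GRing.Theory Num.Theory.

Local Open Scope ring_scope.

Section OrderedPartition.
Variable T : finType.

Definition is_ordered_partition (F : seq {set T}) : bool :=
  [&& (0 < size F)%N,
      set0 \notin F,
      pairwise (fun A B : {set T} => [disjoint A & B]) F
    & \bigcup_(A <- F) A == [set: T]].

(* The blocks are nonempty and pairwise disjoint, so the length bound in the
   type ordered_partition below excludes nothing. *)
Lemma size_ordered_partition (F : seq {set T}) :
  is_ordered_partition F -> (size F <= #|T|)%N.
Proof.
case/and4P=> _ F0 dF _.
have: (size F <= #|\bigcup_(A <- F) A|)%N; last first.
  by move/leq_trans; apply; exact: max_card.
elim: F F0 dF => [|A F IH] //=.
rewrite in_cons negb_or => /andP[A0 F0] /andP[dAF dF].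
have dA : [disjoint A & \bigcup_(B <- F) B].
  rewrite bigcup_seq; apply/bigcup_disjointP => B BF.
  exact: (allP dAF).
rewrite big_cons; move: (leq_card_setU A (\bigcup_(B <- F) B)).2.
rewrite dA => /eqP ->.
by rewrite -add1n leq_add ?IH // card_gt0 eq_sym.
Qed.

Record ordered_partition := OrderedPartition {
  blocks :> #|T|.-bseq {set T};
  _ : is_ordered_partition blocks
}.

HB.instance Definition _ := [isSub for blocks].
HB.instance Definition _ := [Finite of ordered_partition by <:].

Definition nblocks (P : ordered_partition) : nat := size P.

(* Blocks are numbered from 1 to [nblocks P]. *)
Definition block (P : ordered_partition) (u : nat) : {set T} :=
  nth set0 P u.-1.

Definition block_union (P : ordered_partition) (v : nat) : {set T} :=
  \bigcup_(1 <= u < v.+1) block P u.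

(* The u with i in [block P u]. *)
Definition block_index (P : ordered_partition) (i : T) : nat :=
  (find (fun A : {set T} => i \in A) P).+1.

Lemma block_indexP (P : ordered_partition) (i : T) :
  (1 <= block_index P i <= nblocks P)%N /\ i \in block P (block_index P i).
Proof.
have hi: has (fun A : {set T} => i \in A) P.
  case: P => F /= /and4P[_ _ _ /eqP FT].
  have: i \in \bigcup_(A <- F) A by rewrite FT inE.
  by rewrite bigcup_seq => /bigcupP[A AF iA]; apply/hasP; exists A.
by split; [rewrite /nblocks /block_index /= -has_find | exact: (nth_find set0 hi)].
Qed.

End OrderedPartition.

Section OrthogonalProjection.
Variables (R : realType) (V : vectType R) (ip : {dot V for idfun}).
Implicit Type W : {vspace V}.

(* The projection onto W along its orthogonal complement. *)
Definition orth_proj W (x : V) : V := daddv_pi W (orthov ip W) x.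

Lemma ip_eq0 (x : V) : ip x x = 0 -> x = 0.
Proof.
move=> h; apply/eqP; apply: contraT => /(neq0_dnorm_gt0 (s := ip)).
by rewrite h ltxx.
Qed.

Lemma cap_orthov W : (W :&: orthov ip W = 0)%VS.
Proof.
apply/eqP; rewrite -subv0; apply/subvP => x; rewrite memv_cap => /andP[xW].
by move=> /mem_orthovP/(_ x xW)/ip_eq0 ->; rewrite mem0v.
Qed.

Section DualBasis.
Variables (p : nat) (Delta : p.-tuple V).

Definition gram : 'M[R]_p :=
  \matrix_(i, j) ip (tnth Delta i) (tnth Delta j).

(* [dual_basis i] is the vector D(tnth Delta i); see [dual_basisP]. *)
Definition dual_basis (i : 'I_p) : V :=
  \sum_(j < p) invmx gram i j *: tnth Delta j.

Lemma gram_unit : free Delta -> gram \in unitmx.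
Proof.
move=> /freeP freeD; rewrite -row_free_unit -kermx_eq0.
apply/rowV0P => v /sub_kermxP vG.
pose x := \sum_(i < p) v 0 i *: Delta`_i.
have xD j : ip x (tnth Delta j) = 0.
  have := congr1 (fun M : 'rV_p => M 0 j) vG.
  rewrite !mxE => <-; rewrite linear_sumlz; apply: eq_bigr => i _.
  by rewrite mxE linearZl_LR !(tnth_nth 0).
have x0 : x = 0.
  apply: ip_eq0; have -> : ip x x = ip x (\sum_(i < p) v 0 i *: Delta`_i) by [].
  rewrite linear_sumr big1 // => j _.
  by rewrite linearZr_LR /= -(tnth_nth 0) [ip _ _]xD mulr0.
by apply/rowP => i; rewrite mxE; apply: (freeD (fun i => v 0 i)).
Qed.

Lemma dual_basisP (i j : 'I_p) : free Delta ->
  ip (dual_basis i) (tnth Delta j) = (i == j)%:R.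
Proof.
move=> /gram_unit/mulVmx/(congr1 (fun M : 'M_p => M i j)).
rewrite !mxE => <-; rewrite linear_sumlz; apply: eq_bigr => k _.
by rewrite mxE linearZl_LR.
Qed.

End DualBasis.

Lemma orth_proj_mem W (x : V) : orth_proj W x \in W.
Proof. exact: memv_pi. Qed.

Lemma orth_proj_orth W (x : V) : x - orth_proj W x \in orthov ip W.
Proof.
pose w := vbasis W; pose D := dual_basis w.
have fw : free w by apply: basis_free (vbasisP W).
pose y := \sum_i ip x (tnth w i) *: D i.
have yW : y \in W.
  apply: memv_suml => i _; apply/memvZ/memv_suml => j _.
  exact/memvZ/vbasis_mem/mem_tnth.
have xy : x - y \in orthov ip W.
  apply/mem_orthovP => v /coord_vbasis ->.
  rewrite linear_sumr big1 // => k _; rewrite linearZr_LR /=.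
  suff xyw: ip (x - y) w`_k = 0 by rewrite [ip _ _]xyw mulr0.
  rewrite -(tnth_nth 0) linearBl linear_sumlz (bigD1 k) //= big1 => [|i ik].
    by rewrite linearZl_LR /= [ip (D _) _]dual_basisP // eqxx mulr1 addr0 subrr.
  by rewrite linearZl_LR /= [ip (D _) _]dual_basisP // (negPf ik) mulr0.
have cap0 := cap_orthov W.
have xD : x \in (W + orthov ip W)%VS by rewrite -(subrK y x) addrC memv_add.
rewrite -{1}(daddv_pi_add cap0 xD) /orth_proj addrC addKr.
exact: memv_pi.
Qed.

End OrthogonalProjection.

Section Combinatorics.
Variables (R : realType) (V : vectType R) (ip : {dot V for idfun}).

(* The vectors of Delta are referred to by their index in 'I_p: index i stands
   for lambda = tnth Delta i and for mu = D(lambda) = dual_basis ip Delta i, and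
   the ordered partitions of Delta are those of the index set. *)
Variables (p : nat) (Delta : p.-tuple V).
Implicit Types (P : ordered_partition 'I_p) (L H : V).

Definition dual_span P (v : nat) : {vspace V} :=
  <<[seq dual_basis ip Delta i | i in block_union P v]>>%VS.

(* W^u, for 1 <= u <= nblocks P. *)
Definition part_space P (u : nat) : {vspace V} :=
  (dual_span P u :&: orthov ip (dual_span P u.-1))%VS.

Definition lambda_proj P (i : 'I_p) : V :=
  orth_proj ip (part_space P (block_index P i)) (tnth Delta i).

Definition mu_proj P (i : 'I_p) : V :=
  orth_proj ip (part_space P (block_index P i)) (dual_basis ip Delta i).

Definition sign_cond P L H (i : 'I_p) : bool :=
  ((0 < ip (mu_proj P i) L) ==> (ip (lambda_proj P i) H <= 0)) &&
  ((ip (mu_proj P i) L <= 0) ==> (0 < ip (lambda_proj P i) H)).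

Definition phi P L H : int :=
  [forall i, sign_cond P L H i]%:R.

Definition psi P L H : int :=
  ([forall i in block P 1, 0 < ip (lambda_proj P i) H] &&
   [forall i in ~: block P 1, sign_cond P L H i])%:R.

Definition b_count P L : nat := #|[set i | ip (mu_proj P i) L <= 0]|.

Definition c_count P L : nat :=
  #|[set i | (ip (mu_proj P i) L <= 0) && (i \notin block P 1)]|.

Definition alpha P L : nat :=
  (b_count P L + \sum_(1 <= u < (nblocks P).+1) (#|block P u| + 1))%N.

Definition beta P L : nat :=
  (1 + c_count P L + \sum_(2 <= u < (nblocks P).+1) (#|block P u| + 1))%N.

Definition d_Delta L : int := [forall i, 0 < ip (tnth Delta i) L]%:R.

End Combinatorics.

(* Main.v *)
Require Import Defs.
From mathcomp Require Import all_boot all_order all_algebra.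
From mathcomp Require Import reals.
From mathcomp Require Import ring lra.

Set Implicit Arguments.
Unset Strict Implicit.
Unset Printing Implicit Defensive.

Import Order.TTheory GRing.Theory Num.Theory.

Local Open Scope ring_scope.

(* For a face E of the cone {x : lam_i(x) >= 0}, i.e. a subset E of Delta, write
   x in the basis made of the D(lam_i), i in E, and the lam_i, i not in E; let
   y_i(E, x) be its coordinates. For the block F^u of an ordered partition,
   mu_p(Lambda) = y(E^{u-1}, Lambda) and lambda_p(H) = y(E^u, H), so the signs and
   characteristic functions multiply along the chain of the E^v. Projecting x to
   the cone gives Langlands' lemma: for each F there is exactly one E in F with
   y_i(E, x) > 0 on E and y_i(E, x) <= 0 on F \ E. An inclusion-exclusion
   turns it into a signed version for arbitrary sign conditions outside E; it
   rewrites the first factor of each psi-term, and the sum over ordered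
   partitions then telescopes by merging the first two blocks. *)

(** * Orthogonal projections for the inner product *)

Section OrthProj.
Variables (R : realType) (V : vectType R) (ip : {dot V for idfun}).
Implicit Types (W U : {vspace V}) (x y : V).

Lemma ipC x y : ip x y = ip y x.
Proof. by rewrite hermC expr0 mul1r. Qed.

Lemma ipZr a x y : ip x (a *: y) = a * ip x y.
Proof. by rewrite linearZr_LR. Qed.

Lemma ipZl a x y : ip (a *: x) y = a * ip x y.
Proof. by rewrite linearZl_LR. Qed.

Lemma ip_ge0 x : 0 <= ip x x.
Proof.
have [->|/(neq0_dnorm_gt0 (s := ip))/ltW //] := eqVneq x 0.
by rewrite linear0l.
Qed.

Lemma ip_subZ a x y :
  ip (x - a *: y) (x - a *: y) =
  ip x x - a * ip x y *+ 2 + a * (a * ip y y).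
Proof.
rewrite linearBl !linearBr /= !ipZr !ipZl [ip y x]ipC; ring.
Qed.

Lemma orth_projP W x y : y \in W -> ip (x - orth_proj ip W x) y = 0.
Proof. by move=> yW; apply: (mem_orthovP (orth_proj_orth ip W x)). Qed.

Lemma orth_proj_uniq W x y :
  y \in W -> {in W, forall z, ip (x - y) z = 0} -> orth_proj ip W x = y.
Proof.
move=> yW xy; apply/eqP; rewrite -subr_eq0; apply/eqP/(@ip_eq0 _ _ ip).
set z := _ - y; have zW : z \in W by rewrite memvB ?orth_proj_mem.
have {1}-> : z = (x - y) - (x - orth_proj ip W x).
  by rewrite opprB addrC addrA subrK.
by rewrite linearBl /= xy // orth_projP // subr0.
Qed.

(** Both sides equal the inner product of the two projections. *)
Lemma ip_orth_proj W x y : ip (orth_proj ip W x) y = ip x (orth_proj ip W y).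
Proof.
have h u v : ip (orth_proj ip W u) v = ip (orth_proj ip W u) (orth_proj ip W v).
  apply/eqP; rewrite -subr_eq0 -linearBr /= ipC orth_projP //.
  exact: orth_proj_mem.
by rewrite h ipC -h ipC.
Qed.

Lemma orth_proj_min W x y : y \in W ->
  ip (x - y) (x - y) = ip (x - orth_proj ip W x) (x - orth_proj ip W x) +
                       ip (orth_proj ip W x - y) (orth_proj ip W x - y).
Proof.
move=> yW; set u := orth_proj ip W x.
have h : ip (x - u) (u - y) = 0 by rewrite orth_projP // memvB ?orth_proj_mem.
rewrite -hnormDd //; congr (ip _ _); by rewrite addrA subrK.
Qed.

(** With U = U^{u-1} and U' = U^u this computes [mu_proj]. The next lemma computes [lambda_proj],
    whose vector is orthogonal to U^{u-1}. *)
Lemma orth_proj_diff_mem U U' x : (U <= U')%VS -> x \in U' ->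
  orth_proj ip (U' :&: orthov ip U) x = x - orth_proj ip U x.
Proof.
move=> UU' xU'; apply: orth_proj_uniq => [|z].
  by rewrite memv_cap orth_proj_orth memvB // (subvP UU') ?orth_proj_mem.
rewrite memv_cap => /andP[_ /mem_orthovP zU].
by rewrite opprB addrCA subrr addr0 ipC zU ?orth_proj_mem.
Qed.

Lemma orth_proj_diff_orth U U' x : (U <= U')%VS -> x \in orthov ip U ->
  orth_proj ip (U' :&: orthov ip U) x = orth_proj ip U' x.
Proof.
move=> UU' /mem_orthovP xU; apply: orth_proj_uniq => [|z].
  rewrite memv_cap orth_proj_mem; apply/mem_orthovP => v vU.
  rewrite -[orth_proj _ _ _](subrK x) linearDl /= xU // addr0.
  by rewrite -opprB linearNl /= orth_projP ?oppr0 // (subvP UU').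
by rewrite memv_cap => /andP[zU' _]; rewrite orth_projP.
Qed.

End OrthProj.

(** * Faces of the cone generated by the [D i], and Langlands' lemma *)

Section Faces.
Variables (R : realType) (V : vectType R) (ip : {dot V for idfun}).
Variables (I : finType) (lam D : I -> V).
Hypothesis ip_dual : forall i j, ip (D i) (lam j) = (i == j)%:R.
Hypothesis dual_decomp : forall v, v = \sum_i ip v (lam i) *: D i.
Implicit Types (E F : {set I}) (x u : V).

Definition face E : {vspace V} := <<[seq D i | i in E]>>%VS.

Lemma faceS E F : E \subset F -> (face E <= face F)%VS.
Proof.
move=> /subsetP EF; rewrite /face; apply/span_subvP => v /imageP[i iE ->].
by apply/memv_span/image_f/EF.
Qed.

Lemma dual_face i E : i \in E -> D i \in face E.
Proof. by move=> iE; apply/memv_span/image_f. Qed.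

Lemma mem_face E u :
  (u \in face E) = [forall i, (i \notin E) ==> (ip u (lam i) == 0)].
Proof.
apply/idP/forall_inP => [uE i iE|h].
  suff: (face E <= orthov ip <[lam i]>)%VS.
    by move=> /subvP/(_ u uE); rewrite mem_orthov1.
  apply/span_subvP => v /imageP[j jE ->]; rewrite mem_orthov1.
  apply/eqP/(etrans (ip_dual j i)).
  by case: eqVneq jE iE => // -> ->.
rewrite [u]dual_decomp; apply: memv_suml => i _.
have [iE|/h/eqP ->] := boolP (i \in E); last by rewrite scale0r mem0v.
exact/memvZ/dual_face.
Qed.

Lemma face_eq0 E u i : u \in face E -> i \notin E -> ip u (lam i) = 0.
Proof. by rewrite mem_face => /forall_inP/(_ i)/[apply]/eqP. Qed.

Lemma face_decomp E u v : u \in face E ->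
  ip u v = \sum_(i in E) ip u (lam i) * ip v (D i).
Proof.
move=> uE; rewrite {1}[u]dual_decomp linear_sumlz [RHS]big_mkcond /=.
apply: eq_bigr => i _; rewrite ipZl ipC [ip v _]ipC; case: ifPn => // iE.
by rewrite ipC (face_eq0 uE) // mul0r.
Qed.

(* The coordinates of x in the basis made of the [D i], i in E, and of the
   [lam i], i not in E. *)
Definition mixed_coord x E i : R :=
  if i \in E then ip (orth_proj ip (face E) x) (lam i)
  else ip (x - orth_proj ip (face E) x) (D i).

(** Says that the projection of x on the span of the face lies in the relative interior of the
    face. *)
Definition is_pos_face x E :=
  [forall i in E, 0 < ip (orth_proj ip (face E) x) (lam i)].

(* Walk from u towards the projection of x on [face F]; on leaving the cone,
   a coordinate vanishes and F can be reduced. *)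
Lemma pos_face_closer x F u :
    u \in face F -> (forall i, i \in F -> 0 <= ip u (lam i)) ->
  exists E, [/\ E \subset F, is_pos_face x E &
    ip (x - orth_proj ip (face E) x) (x - orth_proj ip (face E) x) <=
      ip (x - u) (x - u)].
Proof.
have [n] := ubnP #|F|; elim: n => // n IH in F u *; rewrite ltnS => Fn uF u0.
set w := orth_proj ip (face F) x.
have wF : w \in face F by apply: orth_proj_mem.
have [wpos|] := boolP (is_pos_face x F).
  by exists F; split => //; rewrite (orth_proj_min ip x uF) lerDl ip_ge0.
rewrite negb_forall => /existsP[i0]; rewrite negb_imply -leNgt => Pi0.
pose P i := (i \in F) && (ip w (lam i) <= 0).
(* The time at which coordinate i vanishes on the segment from [u] to [w]. If it is 0 at both ends,
   division by 0 gives [t i = 0], which still satisfies [tE]. *)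
pose t i := ip u (lam i) / (ip u (lam i) - ip w (lam i)).
have tE i : P i -> t i * (ip u (lam i) - ip w (lam i)) = ip u (lam i).
  case/andP=> /u0 ui wi; rewrite /t; set d := _ - _.
  have [d0|d0] := eqVneq d 0; last by rewrite divfK.
  by rewrite d0 mulr0; move: ui wi d0; rewrite /d; lra.
have t0 i : P i -> 0 <= t i <= 1.
  case/andP=> /u0 ui wi; rewrite /t; set d := _ - _.
  have d0 : 0 <= d by rewrite /d; lra.
  rewrite divr_ge0 //=; have [->|dn] := eqVneq d 0; first by rewrite invr0 mulr0.
  rewrite ler_pdivrMr ?lt_def ?dn // mul1r /d; lra.
case: (@arg_minP _ _ _ i0 P t Pi0) => i Pi tmin.
pose v := u + t i *: (w - u).
have vE j : ip v (lam j) = ip u (lam j) - t i * (ip u (lam j) - ip w (lam j)).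
  rewrite /v linearDl /= ipZl linearBl /=; ring.
have [iF _] := andP Pi; have /andP[ti0 ti1] := t0 i Pi.
have vF : v \in face (F :\ i).
  rewrite mem_face; apply/forall_inP => j; rewrite !inE negb_and negbK.
  rewrite vE => /orP[/eqP ->|jF]; first by rewrite tE // subrr.
  by rewrite !(face_eq0 _ jF) // subrr mulr0 subrr.
have v0 j : j \in F :\ i -> 0 <= ip v (lam j).
  rewrite !inE vE => /andP[_ jF]; have uj := u0 j jF.
  (* If [w] has coordinate j at most 0, then [t i <= t j] by minimality; otherwise coordinate j of
     [v] is a convex combination of nonnegative numbers. *)
  have [wj|wj] := leP (ip w (lam j)) 0.
    have Pj : P j by apply/andP.
    have := tmin j Pj; rewrite -{1}(tE j Pj) -mulrBl => tij.
    apply: mulr_ge0; lra.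
  nra.
have [|E [EF Epos Ev]] := IH (F :\ i) v _ vF v0.
  by rewrite (cardsD1 i F) iF in Fn.
exists E; split=> //; first exact: subset_trans EF (subsetDl _ _).
(* [v] lies between [u] and the projection [w], so by Pythagoras it is at least as close to x as
   [u]. *)
apply: (le_trans Ev); rewrite (orth_proj_min ip x uF) -/w.
have {vF}vF : v \in face F by rewrite memvD // memvZ // memvB.
rewrite (orth_proj_min ip x vF) -/w lerD2l.
have -> : w - v = (1 - t i) *: (w - u).
  by rewrite /v scalerBl scale1r opprD addrA.
rewrite ipZl ipZr mulrA ler_piMl ?ip_ge0 //; nra.
Qed.

(** These are the optimality conditions for the projection of x on [face E] to be the point nearest
    to x in the cone generated by the [D i], i in F. *)
Definition is_langlands_face x F E :=
  [&& E \subset F, [forall i in E, 0 < mixed_coord x E i] &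
      [forall i in F :\: E, mixed_coord x E i <= 0]].

(** Take a positive face E in F nearest to x. If the condition failed at j, a small move along [D j]
    would give a closer point, and [pos_face_closer] a closer positive face. *)
Lemma langlands_face_exists x F : exists E, is_langlands_face x F E.
Proof.
pose N E := ip (x - orth_proj ip (face E) x) (x - orth_proj ip (face E) x).
pose P E := (E \subset F) && is_pos_face x E.
have P0 : P set0.
  by rewrite /P sub0set; apply/forall_inP => i; rewrite inE.
case: (@arg_minP _ _ _ set0 P N P0) => E /andP[EF Epos] Emin.
exists E; apply/and3P; split => //.
  apply/forall_inP => i iE; rewrite /mixed_coord iE.
  exact: (forall_inP Epos).
apply/forall_inP => j; rewrite inE => /andP[jE jF].
rewrite /mixed_coord (negPf jE); set w := orth_proj ip (face E) x.
rewrite leNgt; apply/negP => c0; set c := ip _ _ in c0.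
have Dj : D j != 0.
  apply/eqP => Dj0; have := ip_dual j j.
  by rewrite Dj0 linear0l eqxx => /esym/eqP; rewrite oner_eq0.
have nD := neq0_dnorm_gt0 (s := ip) _ Dj; set n := ip _ _ in nD.
have e0 : 0 < c / n by rewrite divr_gt0.
(* The factor [c / n] minimizes the distance to x along the ray; the squared distance drops by c^2 /
   n. *)
pose u := w + (c / n) *: D j.
have wE : w \in face E by apply: orth_proj_mem.
have uF : u \in face (j |: E).
  by rewrite memvD ?memvZ ?dual_face ?setU11 // (subvP (faceS (subsetUr _ _))).
have u0 i : i \in j |: E -> 0 <= ip u (lam i).
  rewrite !inE /u linearDl /= ipZl ip_dual => /predU1P[->|iE].
    by rewrite (face_eq0 wE) // add0r eqxx mulr1 ltW.
  apply: addr_ge0; first exact/ltW/(forall_inP Epos).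
  by apply: mulr_ge0; [exact: ltW | exact: ler0n].
have [E' [E'F E'pos]] := pos_face_closer x uF u0.
apply/negP; rewrite -ltNge; apply: lt_le_trans (Emin E' _); last first.
  by rewrite /P E'pos (subset_trans E'F) // subUset sub1set jF.
have -> : x - u = (x - w) - (c / n) *: D j by rewrite /u opprD addrA.
rewrite ip_subZ -/c -/n -/(N E).
have -> : c / n * (c / n * n) = c / n * c by rewrite divfK // gt_eqF.
have := mulr_gt0 e0 c0; lra.
Qed.

(** Let w_E be the projection on [face E]. The sign conditions give [ip] of w_E and x - w_E' at most
    0, and symmetrically; the sum of the two bounds forces w_E = w_E'. Then E is recovered as the
    set of positive coordinates. *)
Lemma langlands_face_uniq x F E E' :
  is_langlands_face x F E -> is_langlands_face x F E' -> E = E'.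
Proof.
pose w E := orth_proj ip (face E) x.
have wF A : w A \in face A by apply: orth_proj_mem.
have le A B : is_langlands_face x F A -> is_langlands_face x F B ->
    ip (w A) (x - w B) <= 0.
  move=> /and3P[AF /forall_inP Apos _] /and3P[_ _ /forall_inP Bneg].
  rewrite (face_decomp _ (wF A)); apply: sumr_le0 => i iA.
  have [iB|iB] := boolP (i \in B); first by rewrite orth_projP ?mulr0 ?dual_face.
  apply: mulr_ge0_le0.
    by have := Apos i iA; rewrite /mixed_coord iA => /ltW.
  have := Bneg i; rewrite !inE iB (subsetP AF) // => /(_ isT).
  by rewrite /mixed_coord (negPf iB).
move=> gE gE'; have eqw : w E = w E'.
  apply/eqP; rewrite -subr_eq0; apply/eqP/(@ip_eq0 _ _ ip)/le_anti.
  rewrite ip_ge0 andbT.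
  have {2}-> : w E - w E' = (x - w E') - (x - w E).
    by rewrite opprB [RHS]addrC addrA subrK.
  have z A : ip (w A) x - ip (w A) (w A) = 0.
    by rewrite -linearBr /= ipC orth_projP.
  have := le _ _ gE' gE; have := le _ _ gE gE'; have := z E; have := z E'.
  rewrite linearBl !linearBr /=; lra.
have sub A B : is_langlands_face x F A -> w A = w B -> A \subset B.
  move=> /and3P[_ /forall_inP Apos _] wAB; apply/subsetP => i iA.
  have := Apos i iA; rewrite /mixed_coord iA -/(w A) wAB.
  by case: (boolP (i \in B)) => // /(face_eq0 (wF B)) ->; rewrite ltxx.
by apply/eqP; rewrite eqEsubset !sub.
Qed.

End Faces.

(** * Inclusion-exclusion over sign conditions outside a face *)

Section SignedFaces.
Variables (R : realDomainType) (I : finType) (y : {set I} -> I -> R).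
Implicit Types (A E F : {set I}).

(** The minus sign makes the two cases differ by exactly 1 for every c. *)
Definition signed_ind A i (c : R) : int :=
  if i \in A then (c <= 0)%R%:R else - (0 < c)%R%:R.

Definition face_ind E : int := \prod_(i in E) (0 < y E i)%R%:R.

Definition signed_sum A F : int :=
  \sum_(E : {set I} | E \subset F)
    face_ind E * \prod_(i in F :\: E) signed_ind A i (y E i).

(** Faces containing j do not see whether j is in A. For the others the factor at j changes by 1,
    and what remains is the term of [F :\ j]. *)
Lemma signed_sumU1 A F j : j \in F -> j \notin A ->
  signed_sum (j |: A) F = signed_sum A F + signed_sum A (F :\ j).
Proof.
move=> jF jA; rewrite /signed_sum.
rewrite (bigID (fun E : {set I} => j \in E)) /=.
rewrite [X in _ = X + _](bigID (fun E : {set I} => j \in E)) /= -addrA.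
have sD E : (E \subset F :\ j) = (E \subset F) && (j \notin E).
  by rewrite subsetD1.
congr (_ + _).
  apply: eq_bigr => E /andP[_ jE]; congr (_ * _); apply: eq_bigr => i.
  rewrite inE /signed_ind !inE => /andP[iE _].
  by case: eqVneq iE => // ->; rewrite jE.
rewrite (eq_bigl _ _ sD) -big_split; apply: eq_bigr => E /andP[_ jE] /=.
have jFE : j \in F :\: E by rewrite inE jE.
rewrite -mulrDr; congr (_ * _); rewrite !(big_setD1 _ jFE) /=.
have -> : F :\ j :\: E = (F :\: E) :\ j by rewrite !setDDl setUC.
have -> : \prod_(i in (F :\: E) :\ j) signed_ind (j |: A) i (y E i) =
          \prod_(i in (F :\: E) :\ j) signed_ind A i (y E i).
  apply: eq_bigr => i; rewrite !inE /signed_ind !inE => /andP[ij _].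
  by rewrite (negPf ij).
rewrite -[X in _ = _ + X]mul1r -mulrDl; congr (_ * _).
rewrite /signed_ind setU11 (negPf jA).
by case: ltP.
Qed.

(* Since [c > 0] = 1 - [c <= 0], enlarging A by j in F changes the sum by the
   sum over the faces of F :\ j, and both cancel unless F \subset A. *)
Lemma signed_sumE A F :
  (forall F', \sum_(E : {set I} | E \subset F')
     face_ind E * \prod_(i in F' :\: E) (y E i <= 0)%R%:R = 1) ->
  signed_sum A F = (F \subset A)%:R.
Proof.
move=> langlands; have [n] := ubnP #|F :\: A|; elim: n => // n IH in A F *.
rewrite ltnS => Fn; have [FA|] := boolP (F \subset A).
  rewrite -[RHS](langlands F); apply: eq_bigr => E _; congr (_ * _).
  apply: eq_bigr => i; rewrite inE /signed_ind => /andP[_ iF].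
  by rewrite (subsetP FA).
case/subsetPn=> j jF jA.
have jFA : j \in F :\: A by rewrite inE jA.
have Fn1 : (#|(F :\: A) :\ j| < n)%N.
  by rewrite (cardsD1 j (F :\: A)) jFA in Fn.
have FjA : F :\: (j |: A) = (F :\: A) :\ j by rewrite setDDl setUC.
have FjA' : (F :\ j) :\: A = (F :\: A) :\ j by rewrite !setDDl setUC.
have := signed_sumU1 jF jA; rewrite (IH (j |: A)) ?FjA // (IH A (F :\ j)) ?FjA' //.
by rewrite subDset -[X in X = _]add0r => /addIr <-.
Qed.

End SignedFaces.

(** * Ordered partitions: blocks, merging and splitting *)

Section OrderedPartitionTheory.
Variable T : finType.
Implicit Types (P Q : ordered_partition T) (E F : {set T}) (s : seq {set T}).

Lemma ordered_partitionP P : is_ordered_partition P.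
Proof. by case: P. Qed.

Lemma ordered_partition_inj P Q : P = Q :> seq _ -> P = Q.
Proof. by move=> PQ; do 2!apply: val_inj. Qed.

Lemma block_index_eq P i u : i \in block P u.+1 -> block_index P i = u.+1.
Proof.
rewrite /block /=; have [|uP] := leqP (size P) u.
  by move/(nth_default set0) ->; rewrite inE.
move=> iu; have [] := block_indexP P i.
rewrite /block /nblocks /block_index /=; set v := find _ _ => vP iv.
congr _.+1; have /and4P[_ _ /(pairwiseP set0) dP _] := ordered_partitionP P.
have dis a b : (a < b < size P)%N -> i \in nth set0 P a -> i \in nth set0 P b ->
    false.
  case/andP=> ab bP ia ib; have := dP a b (ltn_trans ab bP) bP ab.
  by move/disjointFr/(_ ia); rewrite ib.
case: (ltngtP u v) => // uv.
  by have := dis u v; rewrite uv vP => /(_ isT iu iv).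
by have := dis v u; rewrite uv uP => /(_ isT iv iu).
Qed.

Lemma in_block P i u : (0 < u)%N -> (i \in block P u) = (block_index P i == u).
Proof.
case: u => // u _; apply/idP/eqP => [/block_index_eq //|<-].
by have [] := block_indexP P i.
Qed.

Lemma block_unionE P v :
  block_union P v = \bigcup_(0 <= u < v) nth set0 P u.
Proof. by rewrite /block_union big_add1. Qed.

Lemma in_block_union P i v : (i \in block_union P v) = (block_index P i <= v)%N.
Proof.
rewrite /block_union; elim: v => [|v IH].
  by rewrite big_geq ?inE.
by rewrite big_nat_recr //= inE IH in_block // [RHS]leq_eqVlt orbC.
Qed.

Lemma block_union1 P : block_union P 1 = block P 1.
Proof. by rewrite /block_union big_nat1. Qed.

Lemma block_unionD P u : (0 < u)%N ->
  block_union P u :\: block_union P u.-1 = block P u.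
Proof.
case: u => // u _; apply/setP => i.
by rewrite inE !in_block_union in_block //= -ltnNge eqn_leq andbC.
Qed.

Lemma prod_blocks (A : comNzRingType) P m (k : T -> A) : (0 < m)%N ->
  \prod_(m <= u < (nblocks P).+1) \prod_(i in block P u) k i =
  \prod_(i | (m <= block_index P i)%N) k i.
Proof.
move=> m0; rewrite big_nat_cond.
under eq_bigr => u /andP[/andP[mu _] _].
  rewrite (eq_bigl (fun i => block_index P i == u)); last first.
    by move=> i; rewrite in_block // (leq_trans m0).
  rewrite big_mkcond; over.
rewrite -big_nat_cond exchange_big /= [RHS]big_mkcond; apply: eq_bigr => i _.
rewrite -big_mkcond /= (eq_bigl (fun u => u == block_index P i)).
  by rewrite big_nat1_eq ltnS; have [/andP[_ ->] _] := block_indexP P i; rewrite andbT.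
by move=> u; rewrite eq_sym.
Qed.

(** Stated as an equality so that it serves both merging and splitting. *)
Lemma is_ordered_partition_merge A B s :
  A != set0 -> B != set0 -> [disjoint A & B] ->
  is_ordered_partition [:: A, B & s] = is_ordered_partition (A :|: B :: s).
Proof.
move=> A0 B0 dAB; rewrite /is_ordered_partition /= !in_cons !negb_or dAB /=.
rewrite !(eq_sym set0) A0 B0 setU_eq0 (negPf A0) /= !big_cons setUA.
congr [&& _, _ & _]; rewrite andbA -all_predI; congr (_ && _).
by apply: eq_all => C /=; rewrite -!setI_eq0 setIUl setU_eq0.
Qed.

Definition mk_ordered_partition s (h : is_ordered_partition s) :
    ordered_partition T :=
  @OrderedPartition T (Bseq (size_ordered_partition h)) h.

Definition merge_seq s := if s is [:: A, B & r] then A :|: B :: r else s.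

Definition split_seq E s := if s is C :: r then [:: E, C :\: E & r] else s.

Lemma two_blocks P A B s : P = [:: A, B & s] :> seq _ ->
  [/\ A != set0, B != set0 & [disjoint A & B]].
Proof.
move=> Ps; have := ordered_partitionP P; rewrite Ps => /and4P[_].
rewrite !in_cons !negb_or !(eq_sym set0) => /and3P[A0 B0 _].
by case/andP=> /andP[dAB _] _ _.
Qed.

Lemma merge_seqP P : is_ordered_partition (merge_seq P).
Proof.
have := ordered_partitionP P; case Ps: (P : seq _) => [|A [|B s]] //=.
have [A0 B0 dAB] := two_blocks Ps.
by rewrite is_ordered_partition_merge.
Qed.

Definition merge_first P : ordered_partition T :=
  mk_ordered_partition (merge_seqP P).

(** [decP] supplies the proof stored in the record; the fallback P is never reached under the
    hypotheses of [split_firstE]. *)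
Definition split_first E P : ordered_partition T :=
  if @decP _ _ (@idP (is_ordered_partition (split_seq E P))) is left h
  then mk_ordered_partition h else P.

Lemma split_firstE E P : E != set0 -> E \proper block P 1 ->
  split_first E P = split_seq E P :> seq _.
Proof.
move=> E0 EP; rewrite /split_first; case: decP => // -[].
have := ordered_partitionP P; move: EP; rewrite /block /=.
case: (P : seq _) => [|C s] //= /andP[EC CE].
rewrite is_ordered_partition_merge //.
- by rewrite -{1}(setIidPr EC) setID.
- by rewrite -subset0 subDset setU0.
by rewrite -setI_eq0 setIDA setIC -setIDA setDv setI0.
Qed.

(* Merging the first two blocks matches the partitions with at least two
   blocks with the pairs of a partition and a nontrivial subset of its first
   block. *)
Section Telescope.
Variables (dl : {set T} -> int) (f : {set T} -> {set T} -> int).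

(** The product starts at 2 because the first block has different factors in the phi-terms and the
    psi-terms. *)
Definition chain_tail P : int :=
  \prod_(2 <= u < (nblocks P).+1) f (block_union P u.-1) (block_union P u).

Lemma chain_tailE P : chain_tail P =
  \prod_(0 <= u < (nblocks P).-1) f (block_union P u.+1) (block_union P u.+2).
Proof.
rewrite /chain_tail; case: nblocks => [|n]; first by rewrite !big_geq.
by rewrite !big_add1.
Qed.

(** Merging removes E^1 from the chain, so only the link from E^1 to E^2 is lost. *)
Lemma chain_tail_merge P : (1 < nblocks P)%N ->
  chain_tail P =
  f (block P 1) (block (merge_first P) 1) * chain_tail (merge_first P).
Proof.
rewrite !chain_tailE -!block_union1 /nblocks /=.
under [X in _ = _ * X]eq_bigr do rewrite !block_unionE /=.
under eq_bigr do rewrite !block_unionE /=.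
rewrite !block_unionE /=.
case: (P : seq _) => [|A [|B s]] //= _.
have h v : \bigcup_(0 <= u < v.+2) nth set0 [:: A, B & s] u =
           \bigcup_(0 <= u < v.+1) nth set0 (A :|: B :: s) u.
  by rewrite !big_nat_recl //= setUA.
rewrite big_nat_recl // !h; congr (_ * _).
by apply: eq_bigr => u _; rewrite !h.
Qed.

Lemma sum_merge_first :
  \sum_(P : ordered_partition T | (1 < nblocks P)%N)
     dl (block P 1) * chain_tail P =
  \sum_(P : ordered_partition T)
    \sum_(E : {set T} | (E != set0) && (E \proper block P 1))
      dl E * f E (block P 1) * chain_tail P.
Proof.
rewrite pair_big_dep /=.
rewrite [RHS](reindex_onto (fun P => (merge_first P, block P 1))
                           (fun PE => split_first PE.2 PE.1)) /=.
  apply: eq_big => [P|P P2]; last by rewrite chain_tail_merge // mulrA.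
  apply/idP/andP => [P2|[/andP[E0 EP] /eqP]].
    have h : block P 1 != set0 /\ block P 1 \proper block (merge_first P) 1.
      move: P2; rewrite /nblocks /block /=; case Ps: (P : seq _) => [|A [|B s]] //=.
      have [A0 B0 dAB] := two_blocks Ps; split=> //.
      rewrite properE subsetUl subUset subxx /=; apply: contra B0 => BA.
      by rewrite -(setIidPr BA) setI_eq0.
    have [h1 h2] := h; rewrite h1 h2; split=> //.
    apply/eqP/ordered_partition_inj; rewrite split_firstE //.
    move: P2; rewrite /nblocks /block /=; case Ps: (P : seq _) => [|A [|B s]] //= _.
    have [A0 B0 dAB] := two_blocks Ps; congr [:: _, _ & _].
    rewrite setDUl setDv set0U; apply/setDidPl.
    by rewrite disjoint_sym.
  move=> <-; rewrite /nblocks split_firstE //.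
  (* With fewer than two blocks merging changes nothing, and no set is a proper subset of itself. *)
  move: EP; rewrite /block /=.
  by case: (P : seq _) => [|A [|B s]] //=; rewrite properxx.
case=> P E /= /andP[E0 EP].
have hs := split_firstE E0 EP.
congr (_, _); first apply: ordered_partition_inj => /=; rewrite ?/block hs.
  move: EP; rewrite /block /=; case: (P : seq _) => [|C s] //= /proper_sub EC.
  by rewrite -{1}(setIidPr EC) setID.
move: EP; rewrite /block /=; case: (P : seq _) => [|C s] //= /proper_sub.
by rewrite subset0 => /eqP.
Qed.

(** By [sum_merge_first] the subtracted sum cancels all partitions with at least two blocks; only
    the one-block partition survives. *)
Lemma sum_chains_telescope : (0 < #|T|)%N ->
  \sum_(P : ordered_partition T)
     (dl (block P 1) -
      \sum_(E : {set T} | (E != set0) && (E \proper block P 1))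
         dl E * f E (block P 1)) * chain_tail P = dl setT.
Proof.
move=> T0; under eq_bigr do rewrite mulrBl mulr_suml.
rewrite sumrB -sum_merge_first (bigID (fun P => 1 < nblocks P)%N) /= addrC addrK.
have h : is_ordered_partition [:: [set: T]].
  rewrite /is_ordered_partition /= big_seq1 eqxx inE eq_sym !andbT.
  by rewrite -card_gt0 cardsT.
rewrite (big_pred1 (mk_ordered_partition h)) => [|P].
  by rewrite chain_tailE /= big_geq // mulr1.
apply/idP/eqP => [|-> //]; rewrite -leqNgt => P1.
apply: ordered_partition_inj => /=; move: P1; rewrite /nblocks.
have /and4P[] := ordered_partitionP P.
case: (P : seq _) => [|A [|B s]] //= _ _ _ /eqP.
by rewrite big_seq1 => ->.
Qed.

End Telescope.
End OrderedPartitionTheory.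

Lemma prod_ind (T : finType) (S : {set T}) (a : pred T) :
  \prod_(i in S) (a i)%:R = [forall i in S, a i]%:R :> int.
Proof.
case: forall_inP => [h|/forall_inP]; first by rewrite big1 // => i /h ->.
rewrite negb_forall => /existsP[i]; rewrite negb_imply => /andP[iS /negPf ai].
by rewrite (bigD1 i) //= ai mul0r.
Qed.

Lemma prod_sign (T : finType) (S : {set T}) (a : pred T) :
  \prod_(i in S) (-1) ^+ a i = (-1) ^+ #|[set i in S | a i]| :> int.
Proof.
rewrite -prodr_const big_mkcond [RHS]big_mkcond; apply: eq_bigr => i _.
by rewrite inE; case: (i \in S); case: (a i).
Qed.

(** * Factorization of the phi-terms and psi-terms along chains *)

Section Chains.
Variables (R : realType) (V : vectType R) (ip : {dot V for idfun}).
Variables (p : nat) (Delta : p.-tuple V).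
Hypothesis basisDelta : basis_of fullv Delta.
Variables (L H : V).
Implicit Types (P : ordered_partition 'I_p) (E F : {set 'I_p}).

Let lam (i : 'I_p) : V := tnth Delta i.
Let D := dual_basis ip Delta.

Let ip_dual i j : ip (D i) (lam j) = (i == j)%:R.
Proof. exact/dual_basisP/(basis_free basisDelta). Qed.

Let dual_decomp v : v = \sum_i ip v (lam i) *: D i.
Proof.
apply/eqP; rewrite -subr_eq0; apply/eqP/(@ip_eq0 _ _ ip); set d := _ - _.
have dl i : ip d (lam i) = 0.
  rewrite linearBl linear_sumlz /= (bigD1 i) //= big1 => [|j ji].
    by rewrite ipZl ip_dual eqxx mulr1 addr0 subrr.
  by rewrite ipZl ip_dual (negPf ji) mulr0.
have -> : ip d d = ip d (\sum_i coord Delta i d *: Delta`_i).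
  by rewrite -(coord_basis basisDelta) ?memvf.
rewrite linear_sumr big1 // => i _.
by rewrite linearZr_LR /= -tnth_nth [ip _ _]dl mulr0.
Qed.

Let yL E i := mixed_coord ip lam D L E i.
Let yH E i := mixed_coord ip lam D H E i.

(** [D i] lies in U^u, so its projection on W^u only removes the U^{u-1} component, which
    self-adjointness moves to L. *)
Lemma ip_mu_proj P i : ip (mu_proj ip Delta P i) L =
  yL (block_union P (block_index P i).-1) i.
Proof.
rewrite /mu_proj /part_space; set u := block_index P i.
have iu : i \in block_union P u by rewrite in_block_union.
have iu' : i \notin block_union P u.-1 by rewrite in_block_union -ltnNge.
rewrite orth_proj_diff_mem ?(faceS D) ?(dual_face D) //; last first.
  by apply/subsetP => j; rewrite !in_block_union => /leq_trans; apply.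
rewrite /yL /mixed_coord (negPf iu') linearBl /= ip_orth_proj -linearBr /=.
exact: ipC.
Qed.

(** By duality [lam i] is orthogonal to U^{u-1}, so projecting it on W^u or on U^u is the same. *)
Lemma ip_lambda_proj P i : ip (lambda_proj ip Delta P i) H =
  yH (block_union P (block_index P i)) i.
Proof.
rewrite /lambda_proj /part_space; set u := block_index P i.
have iu : i \in block_union P u by rewrite in_block_union.
have iu' : i \notin block_union P u.-1 by rewrite in_block_union -ltnNge.
rewrite orth_proj_diff_orth ?(faceS D) //.
- by rewrite /yH /mixed_coord iu ip_orth_proj; apply: ipC.
- by apply/subsetP => j; rewrite !in_block_union => /leq_trans; apply.
apply/mem_orthovP => v vu; apply: etrans (ipC _ _ _) _.
exact: (face_eq0 ip_dual dual_decomp vu).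
Qed.

(** The factor of the block [F :\: E]: the outer sign is the 1 in a^u + 1, while (-1)^{a^u} is
    spread over the indices and absorbed in [signed_ind]. *)
Definition chain_weight E F : int :=
  - \prod_(i in F :\: E) signed_ind [set j | 0 < yH F j] i (yL E i).

(** Existence and uniqueness of the Langlands face: exactly one term is 1. *)
Lemma langlands_sum F :
  \sum_(E : {set 'I_p} | E \subset F)
     face_ind yL E * \prod_(i in F :\: E) (yL E i <= 0)%R%:R = 1.
Proof.
have [E0 E0F] := langlands_face_exists ip_dual dual_decomp L F.
rewrite (bigD1 E0) /=; last by case/and3P: E0F.
rewrite [X in _ + X]big1 => [|E /andP[EF EE0]].
  by case/and3P: E0F => _ h1 h2; rewrite /face_ind !prod_ind h1 h2 addr0.
rewrite /face_ind !prod_ind -natrM mulnb; apply/eqP; rewrite pnatr_eq0 eqb0.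
apply: contra EE0 => h; apply/eqP.
apply: (langlands_face_uniq ip_dual dual_decomp _ E0F).
by rewrite /is_langlands_face EF.
Qed.

(** This is [signed_sumE] for A the set where [yH F] is positive, with the terms E = F and E =
    [set0] split off; they are distinct since F is nonempty. *)
Lemma face_ind_chain_weight F : F != set0 ->
  \prod_(i in F) (0 < yH F i)%R%:R + chain_weight set0 F =
  face_ind yL F - \sum_(E : {set 'I_p} | (E != set0) && (E \proper F))
                     face_ind yL E * chain_weight E F.
Proof.
move=> F0; have := signed_sumE [set j | 0 < yH F j] F langlands_sum.
have -> : (F \subset [set j | 0 < yH F j]) = [forall i in F, 0 < yH F i].
  apply/subsetP/forall_inP => h i /h; by rewrite inE.
rewrite -prod_ind => <-; rewrite /signed_sum (bigD1 F) //= (bigD1 set0) /=.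
  rewrite setDv big_set0 mulr1 {2}/face_ind big_set0 mul1r -addrA; congr (_ + _).
  rewrite /chain_weight addrAC subrr add0r -sumrN.
  apply: eq_big => [E|E _]; last by rewrite mulrN opprK.
  by rewrite [RHS]andbC properEneq [X in _ = X && _]andbC.
by rewrite sub0set eq_sym.
Qed.

Let k P i : int :=
  (-1) ^+ (ip (mu_proj ip Delta P i) L <= 0)%R *
  (sign_cond ip Delta P L H i)%:R.

Lemma chain_weight_block P u : (0 < u)%N ->
  chain_weight (block_union P u.-1) (block_union P u) =
  (-1) ^+ (#|block P u| + 1) * \prod_(i in block P u) k P i.
Proof.
move=> u0; rewrite /chain_weight block_unionD // exprD expr1 mulrN1 mulNr.
congr (- _); rewrite -prodr_const -big_split; apply: eq_bigr => i /=.
rewrite in_block // => /eqP iu.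
rewrite /k /signed_ind /sign_cond ip_mu_proj ip_lambda_proj iu inE.
by case: (ltP 0 (yL _ _)); case: (ltP 0 (yH _ _)) => //=; rewrite ?mulr0 ?mulr1.
Qed.

(** Used with m = 1 for [alpha] and [phi], and with m = 2 for [beta] and [psi]. *)
Lemma prod_chain_weight P m (S : {set 'I_p}) : (0 < m)%N ->
    S =i [pred i | m <= block_index P i]%N ->
  \prod_(m <= u < (nblocks P).+1)
     chain_weight (block_union P u.-1) (block_union P u) =
  (-1) ^+ (#|[set i in S | ip (mu_proj ip Delta P i) L <= 0]| +
           \sum_(m <= u < (nblocks P).+1) (#|block P u| + 1)) *
  [forall i in S, sign_cond ip Delta P L H i]%:R.
Proof.
move=> m0 SE; rewrite big_nat_cond.
under eq_bigr => u /andP[/andP[mu _] _].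
  rewrite chain_weight_block ?(leq_trans m0) //; over.
rewrite -big_nat_cond big_split /= prod_blocks // addnC exprD -mulrA.
rewrite (big_morph _ (exprD (-1)) (expr0 (-1))); congr (_ * _).
by rewrite -prod_sign -prod_ind -big_split; apply/esym/eq_bigl.
Qed.

Lemma alpha_phi P : (-1) ^+ alpha ip Delta P L * phi ip Delta P L H =
  chain_weight set0 (block P 1) * chain_tail chain_weight P.
Proof.
have P0 : (0 < nblocks P)%N by case/and4P: (ordered_partitionP P).
have -> : chain_weight set0 (block P 1) * chain_tail chain_weight P =
    \prod_(1 <= u < (nblocks P).+1)
       chain_weight (block_union P u.-1) (block_union P u).
  by rewrite [RHS]big_ltn // block_union1 /block_union big_geq.
rewrite (prod_chain_weight (S := setT)) // => [|i]; last by rewrite !inE.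
congr ((-1) ^+ (_ + _) * _%:R); first by apply: eq_card => i; rewrite !inE.
by congr nat_of_bool; apply: eq_forallb => i; rewrite inE.
Qed.

(** The leading 1 in [beta] is the outer minus sign. *)
Lemma beta_psi P : (-1) ^+ beta ip Delta P L * psi ip Delta P L H =
  - (\prod_(i in block P 1) (0 < yH (block P 1) i)%R%:R *
     chain_tail chain_weight P).
Proof.
rewrite /chain_tail (prod_chain_weight (S := ~: block P 1)) // => [|i]; last first.
  rewrite !inE in_block //; have [/andP[]] := block_indexP P i.
  by move=> bi0 _ _; rewrite [RHS]ltn_neqAle eq_sym bi0 andbT.
rewrite prod_ind /beta /psi -mulnb natrM -addnA add1n exprS mulN1r mulNr.
congr (- _); rewrite [LHS]mulrCA; congr (_%:R * (_ * _)).
  congr nat_of_bool; apply: eq_forallb_in => i.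
  by rewrite in_block // => /eqP i1; rewrite ip_lambda_proj i1 block_union1.
by congr (_ ^+ (_ + _)); apply: eq_card => i; rewrite !inE andbC.
Qed.

(** The face of all indices spans V, so the projection is the identity. *)
Lemma d_DeltaE : d_Delta ip Delta L = face_ind yL setT.
Proof.
rewrite /face_ind prod_ind /d_Delta; congr (nat_of_bool _)%:R.
apply: eq_forallb => i; rewrite inE /yL /mixed_coord inE.
have -> : orth_proj ip (face D setT) L = L; last by rewrite ipC.
apply: orth_proj_uniq => [|z _]; last by rewrite subrr linear0l.
rewrite (mem_face ip_dual dual_decomp); apply/forall_inP => j.
by rewrite inE.
Qed.

End Chains.

Theorem proposition2p1 (R : realType) (V : vectType R)
    (ip : {dot V for idfun}) (p : nat) (p_ge1 : (1 <= p)%N)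
    (dimV : \dim {:V} = p) (Delta : p.-tuple V)
    (basisDelta : basis_of fullv Delta) (L H : V) :
  \sum_(P : ordered_partition 'I_p)
     (-1) ^+ alpha ip Delta P L * phi ip Delta P L H =
  d_Delta ip Delta L +
  \sum_(P : ordered_partition 'I_p)
     (-1) ^+ beta ip Delta P L * psi ip Delta P L H.
Proof.
rewrite (d_DeltaE ip basisDelta); set dl := face_ind _.
(* Telescoping backwards writes d_Delta as a sum over ordered partitions, so the identity can be
   checked for each P, where [chain_tail] is a common factor. *)
rewrite -(sum_chains_telescope dl (chain_weight ip Delta L H)) ?card_ord //.
rewrite -big_split.
apply: eq_bigr => P _ /=.
have P1 : block P 1 != set0.
  case/and4P: (ordered_partitionP P); rewrite /block /=.
  case: (P : seq _) => //= C s _.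
  by rewrite in_cons negb_or eq_sym => /andP[].
rewrite (alpha_phi ip basisDelta) (beta_psi ip basisDelta) -mulrBl.
rewrite -(face_ind_chain_weight ip basisDelta) //.
by congr (_ * _); rewrite addrAC subrr add0r.
Qed.
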